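(* Let $W=\langle r_1,r_2\mid r_1^2=r_2^2=1\rangle$ be the infinite dihedral group (the affine Coxeter group of type $\widetilde A_1$, with $m_{12}=\infty$). Then its Cayley graph with respect to $\{r_1,r_2\}$ satisfies the strong hull property: for all $u,v,w\in W$, $|\mathrm{Conv}(u,v)|\cdot|\mathrm{Conv}(v,w)|\ge|\mathrm{Conv}(u,v,w)|$.
   Context: The Cayley graph has vertex set $W$, with $u,v$ adjacent iff $u^{-1}v\in\{r_1,r_2\}$; $d$ is the shortest-path distance. A vertex set $C$ is convex if $u,v\in C$ and $d(u,w)+d(w,v)=d(u,v)$ imply $w\in C$. $\mathrm{Conv}(X)$ is the smallest convex set containing $X$. The strong hull property is the stated inequality holding for all triples of vertices. *)

(* Defs.v *)
From HB Require Import structures.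
From mathcomp Require Import all_boot.
From mathcomp Require Import mathcomp_extra boolp classical_sets cardinality.

Set Implicit Arguments.
Unset Strict Implicit.
Unset Printing Implicit Defensive.

Local Open Scope group_scope.
Local Open Scope classical_set_scope.
Local Open Scope quotient_scope.
Local Open Scope card_scope.

(** * Groups given by generators and relators *)

Section Presentation.
Variables (A : choiceType) (rels : set (seq (A * bool))).

(* The letter (a, false) stands for the generator a, (a, true) for its formal
   inverse. *)
Notation word := (seq (A * bool)).

Definition inv_letter (l : A * bool) : A * bool := (l.1, ~~ l.2).

Definition inv_word (s : word) : word := rev (map inv_letter s).

(* The least congruence on words that makes l and inv_letter l mutually inverse
   and every relator trivial. *)
Inductive word_eq : word -> word -> Prop :=
| word_eq_refl s : word_eq s s
| word_eq_sym s t : word_eq s t -> word_eq t s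
| word_eq_trans s t u : word_eq s t -> word_eq t u -> word_eq s u
| word_eq_cat s s' t t' :
    word_eq s s' -> word_eq t t' -> word_eq (s ++ t) (s' ++ t')
| word_eq_inv l : word_eq [:: l; inv_letter l] [::]
| word_eq_rel s : rels s -> word_eq s [::].

Definition word_eqb (s t : word) : bool := `[< word_eq s t >].

Lemma word_eqb_refl : reflexive word_eqb.
Proof. by move=> s; apply/asboolP; exact: word_eq_refl. Qed.

Lemma word_eqb_sym : symmetric word_eqb.
Proof. by move=> s t; apply/asboolP/asboolP; exact: word_eq_sym. Qed.

Lemma word_eqb_trans : transitive word_eqb.
Proof.
move=> t s u /asboolP st /asboolP tu; apply/asboolP.
exact: word_eq_trans st tu.
Qed.

Canonical word_equiv := EquivRel word_eqb
  word_eqb_refl word_eqb_sym word_eqb_trans.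

Definition presented : Type := {eq_quot word_equiv}.

HB.instance Definition _ := Choice.on presented.

Definition pres_class (s : word) : presented := \pi_({eq_quot word_equiv}) s.

Definition pres_repr (x : presented) : word :=
  repr (x : {eq_quot word_equiv}).

Definition pres_one : presented := pres_class [::].
Definition pres_mul (x y : presented) : presented :=
  pres_class (pres_repr x ++ pres_repr y).
Definition pres_inv (x : presented) : presented :=
  pres_class (inv_word (pres_repr x)).

Lemma pres_reprK : cancel pres_repr pres_class.
Proof. by move=> x; rewrite /pres_class /pres_repr reprK. Qed.

Lemma pres_classP (s t : word) : pres_class s = pres_class t <-> word_eq s t.
Proof.
rewrite /pres_class; split => [/eqmodP|st]; first by move=> /asboolP.
by apply/eqmodP/asboolP.
Qed.

Lemma pres_classK (s : word) : word_eq (pres_repr (pres_class s)) s.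
Proof. by apply/pres_classP; rewrite pres_reprK. Qed.

Lemma inv_letterK : involutive inv_letter.
Proof. by case=> a b; rewrite /inv_letter /= negbK. Qed.

Lemma inv_wordK : involutive inv_word.
Proof.
move=> s; rewrite /inv_word map_rev revK -map_comp -[RHS]map_id.
by apply: eq_map => l /=; rewrite inv_letterK.
Qed.

Lemma word_eq_mulV (s : word) : word_eq (s ++ inv_word s) [::].
Proof.
elim: s => [|l s IHs]; first exact: word_eq_refl.
rewrite /inv_word /= rev_cons -cats1 catA -/(inv_word s).
apply: (word_eq_trans _ (word_eq_inv l)).
rewrite -[X in word_eq X]/([:: l] ++ ((s ++ inv_word s) ++ [:: inv_letter l])).
rewrite -[X in word_eq _ X]/([:: l] ++ ([::] ++ [:: inv_letter l])).
apply: word_eq_cat; first exact: word_eq_refl.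
by apply: word_eq_cat => //; exact: word_eq_refl.
Qed.

Lemma pres_classM (s t : word) :
  pres_class (s ++ t) = pres_mul (pres_class s) (pres_class t).
Proof.
apply/pres_classP/word_eq_sym/word_eq_cat; exact: pres_classK.
Qed.

Lemma pres_mulA : associative pres_mul.
Proof.
move=> x y z; rewrite -[x]pres_reprK -[y]pres_reprK -[z]pres_reprK.
by rewrite -!pres_classM catA.
Qed.

Lemma pres_mul1 : left_id pres_one pres_mul.
Proof. by move=> x; rewrite -[x]pres_reprK -pres_classM. Qed.

Lemma pres_mulr1 : right_id pres_one pres_mul.
Proof. by move=> x; rewrite -[x]pres_reprK -pres_classM cats0. Qed.

Lemma pres_mulV : right_inverse pres_one pres_inv pres_mul.
Proof.
move=> x; rewrite -[X in pres_mul X]pres_reprK -pres_classM.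
by apply/pres_classP; exact: word_eq_mulV.
Qed.

Lemma pres_mulVl : left_inverse pres_one pres_inv pres_mul.
Proof.
move=> x; rewrite -[X in pres_mul _ X]pres_reprK -pres_classM.
by apply/pres_classP; rewrite -{2}[pres_repr x]inv_wordK; exact: word_eq_mulV.
Qed.

HB.instance Definition _ := isGroup.Build presented
  pres_mulA pres_mul1 pres_mulr1 pres_mulVl pres_mulV.

Definition pres_gen (a : A) : presented := pres_class [:: (a, false)].

End Presentation.

(** * The infinite dihedral group < r1, r2 | r1^2 = r2^2 = 1 > *)

(* The index false stands for r1 and true for r2. *)
Definition dihedral_rels : set (seq (bool * bool)) :=
  [set s | exists a : bool, s = [:: (a, false); (a, false)]].

Definition W : groupType := presented dihedral_rels.

Definition r1 : W := pres_gen dihedral_rels false.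
Definition r2 : W := pres_gen dihedral_rels true.

(** * Graph distance, convexity and the strong hull property *)

Definition cayley (G : groupType) (S : seq G) : rel G :=
  fun u v => u^-1 * v \in S.

Section Convexity.
Variables (V : eqType) (adj : rel V).

Definition is_walk (n : nat) (u v : V) : Prop :=
  exists p : seq V, [/\ path adj u p, last u p = v & size p = n].

(* The length of a shortest walk; the default value 0 is only taken when v is
   not reachable from u, which does not happen in a connected graph. *)
Definition dist (u v : V) : nat :=
  xget 0%N [set n | is_walk n u v /\ forall m, is_walk m u v -> (n <= m)%N].

Definition convex (C : set V) : Prop :=
  forall u v w, C u -> C v -> (dist u w + dist w v = dist u v)%N -> C w.

Definition Conv (X : set V) : set V := smallest convex X.

(* The product of two cardinals is the cardinal of the cartesian product, and
   cardinals are compared by injections, so no finiteness convention is needed. *)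
Definition strong_hull_property : Prop :=
  forall u v w : V,
    Conv [set u; v; w] #<= Conv [set u; v] `*` Conv [set v; w].

End Convexity.

(* Main.v *)
(** The Cayley graph of W is a bi-infinite path: letting generators act on the
    right of the integers, where r1 exchanges 2k with 2k+1 and r2 exchanges 2k-1
    with 2k, the orbit map [pos] of 0 is an isometry of W onto the integers.
    Hence, writing [a, b] for the set of vertices between a and b, the union
    of [u, v] and [v, w] is convex, so it contains Conv(u, v, w).  The map
    sending x to (x, v) if x lies in [u, v] and to (v, x) otherwise is injective
    from this union into Conv(u, v) x Conv(v, w). *)
Require Import Defs.
From mathcomp Require Import all_boot.
From mathcomp Require Import ssralg ssrnum ssrint.
From mathcomp Require Import boolp classical_sets functions cardinality.
From mathcomp Require Import zify.

Set Implicit Arguments.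
Unset Strict Implicit.
Unset Printing Implicit Defensive.

Local Open Scope group_scope.
Local Open Scope classical_set_scope.

Definition step (n : int) (a : bool) : int :=
  if odd `|n| == a then (n + 1)%R else (n - 1)%R.

Lemma stepK (a : bool) (n : int) : step (step n a) a = n.
Proof. rewrite /step; case: eqP; case: eqP; lia. Qed.

(** The sign [l.2] is ignored because a generator and its formal inverse act by the same
    involution. *)
Definition run (n : int) (s : seq (bool * bool)) : int :=
  foldl (fun m l => step m l.1) n s.

(** Cancelling pairs and relators both apply the same [step] twice, which [stepK] undoes; so the
    action descends to [W]. *)
Lemma run_word_eq (s t : seq (bool * bool)) (n : int) :
  word_eq dihedral_rels s t -> run n s = run n t.
Proof.
move=> st; elim: st n => //.
- by move=> s1 t1 u _ IH1 _ IH2 n; rewrite IH1.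
- move=> s1 s2 t1 t2 _ IHs _ IHt n.
  by rewrite /run !foldl_cat -!/(run _ _) IHs IHt.
- by move=> l n; rewrite /= stepK.
- by move=> _ [a ->] n; rewrite /= stepK.
Qed.

Definition gen (a : bool) : W := pres_gen dihedral_rels a.

Lemma genK (a : bool) (x : W) : x * gen a * gen a = x.
Proof.
rewrite -mulgA -[gen a * gen a]pres_classM.
suff -> : pres_class dihedral_rels ([:: (a, false)] ++ [:: (a, false)]) = 1.
  exact: mulg1.
by apply/pres_classP/word_eq_rel; exists a.
Qed.

Lemma pres_class_rcons (s : seq (bool * bool)) (l : bool * bool) :
  pres_class dihedral_rels (rcons s l) =
  (pres_class dihedral_rels s : W) * gen l.1.
Proof.
rewrite -cats1 pres_classM; case: l => a [] //=.
(* The letter left is the formal inverse of [a]; it cancels one of two inserted copies of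
   [gen a]. *)
rewrite -[LHS](genK a); congr (_ * _); rewrite -[LHS]mulgA.
rewrite -[X in _ * X]pres_classM -[RHS]mulg1; congr (_ * _).
by apply/pres_classP/(word_eq_inv _ (a, true)).
Qed.

Definition pos (x : W) : int := run 0%R (pres_repr x).

Lemma pos_class (s : seq (bool * bool)) :
  pos (pres_class dihedral_rels s) = run 0%R s.
Proof. exact/run_word_eq/pres_classK. Qed.

Lemma pos_gen (x : W) (a : bool) : pos (x * gen a) = step (pos x) a.
Proof.
rewrite -[x in LHS]pres_reprK -[gen a]/(gen (a, false).1) -pres_class_rcons.
by rewrite pos_class /run foldl_rcons.
Qed.

Fixpoint alt (a : bool) (n : nat) : W :=
  if n is m.+1 then alt a m * gen (a (+) odd m) else 1.

(** Alternating words starting with [r1] label the positive integers, those starting with [r2] the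
    negative ones; [Negz m] is -(m+1), hence the length [m.+1]. *)
Definition vtx (n : int) : W :=
  match n with Posz m => alt false m | Negz m => alt true m.+1 end.

(** A step away from 0 appends the next alternating letter; a step towards 0 cancels the last
    one. *)
Lemma vtx_step (n : int) (a : bool) : vtx (step n a) = vtx n * gen a.
Proof.
rewrite /step; case: n => n.
  case: eqP => [<-|].
    by rewrite (_ : _ + _ = Posz n.+1)%R //; lia.
  case: n => [|n]; first by case: a.
  rewrite (_ : _ - _ = Posz n)%R; last by lia.
  move=> na; have -> : a = odd n by move: na => /=; case: a; case: (odd n).
  by rewrite /= genK.
rewrite [`|_|]/=; case: eqP => [<-|na].
  case: n => [|n]; first by rewrite /= genK.
  rewrite (_ : _ + _ = Negz n)%R; last by lia.
  by rewrite /= negbK genK.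
have -> : a = odd n by move: na => /=; case: a; case: (odd n).
rewrite (_ : _ - _ = Negz n.+1)%R; last by lia.
by rewrite /= negbK.
Qed.

Lemma posK : cancel pos vtx.
Proof.
move=> x; rewrite -[x]pres_reprK pos_class.
elim/last_ind: (pres_repr x) => [//|s l IH].
by rewrite pres_class_rcons -IH -vtx_step /run foldl_rcons.
Qed.

Notation adj := (cayley [:: r1; r2]).

Lemma adjP (u v : W) : reflect (exists a, v = u * gen a) (adj u v).
Proof.
rewrite /cayley !inE; apply: (iffP orP) => [[] /eqP h|[[] ->]].
- by exists false; rewrite -[gen false]h mulVKg.
- by exists true; rewrite -[gen true]h mulVKg.
- by right; rewrite mulKg.
- by left; rewrite mulKg.
Qed.

Lemma walk_pos (n : nat) (u v : W) :
  is_walk adj n u v -> `|(pos u - pos v)%R| <= n.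
Proof.
move=> [p [+ <- <-]]; elim: p u => [|x p IH] u /=; first by lia.
move=> /andP[/adjP[a ->] /IH]; rewrite pos_gen /step.
by move: (pos u) (pos (last _ p)) (size p) => y z m; case: ifP => _; lia.
Qed.

Lemma pos_walk (u v : W) : is_walk adj `|(pos u - pos v)%R| u v.
Proof.
move: {-2}`|(pos u - pos v)%R| (erefl `|(pos u - pos v)%R|) => n.
elim: n u => [|n IH] u uv.
  by exists [::]; split => //=; apply: (can_inj posK); lia.
(* The parity of [pos u] tells which generator goes up; [a] is the one leading from [u] towards
   [v]. *)
pose a := if (pos u < pos v)%R then odd `|pos u| else ~~ odd `|pos u|.
have /IH[p [pp lp sp]] : n = `|(pos (u * gen a)%g - pos v)%R|.
  rewrite pos_gen /step /a; case: (boolP (pos u < pos v)%R) => lt_uv.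
    by rewrite eqxx; lia.
  by case: (odd _) => /=; lia.
exists (u * gen a :: p); split => //=; last by rewrite sp.
by rewrite pp andbT; apply/adjP; exists a.
Qed.

Lemma dist_pos (u v : W) : dist adj u v = `|(pos u - pos v)%R|.
Proof.
rewrite /dist; case: xgetP => [n _ [/walk_pos n_ge n_min]|].
  by apply/eqP; rewrite eqn_leq n_ge n_min//; exact: pos_walk.
(* The default value of [xget] is ruled out, as the minimum is attained. *)
move=> /(_ `|(pos u - pos v)%R|); case.
by split; [exact: pos_walk | move=> m; exact: walk_pos].
Qed.

Definition between (u v : W) : set W :=
  [set x | (dist adj u x + dist adj x v = dist adj u v)%N].

Lemma between_sub_Conv (u v : W) : between u v `<=` Conv adj [set u; v].
Proof.
move=> x uxv C [Cconv uvC].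
by apply: (Cconv u v x) => //; apply: uvC; [left | right].
Qed.

(** Both integer intervals contain [pos v], so their union has no gap. *)
Lemma between_unionP (u v w x : W) :
  (between u v `|` between v w) x <->
  (Num.min (pos u) (Num.min (pos v) (pos w)) <= pos x <=
   Num.max (pos u) (Num.max (pos v) (pos w)))%R.
Proof. by rewrite /between /= !dist_pos; lia. Qed.

Lemma convex_between_union (u v w : W) :
  convex adj (between u v `|` between v w).
Proof.
move=> x y z /between_unionP x_uvw /between_unionP y_uvw.
by rewrite !dist_pos => xzy; apply/between_unionP; lia.
Qed.

Lemma Conv_sub_between_union (u v w : W) :
  Conv adj [set u; v; w] `<=` between u v `|` between v w.
Proof.
apply: smallest_sub; first exact: convex_between_union.
by move=> _ [[->|->]|->]; rewrite /between /= !dist_pos; lia.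
Qed.

Theorem theorem2p6 : strong_hull_property (cayley [:: r1; r2]).
Proof.
move=> u v w.
pose f x := if `[< between u v x >] then (x, v) else (v, x).
have [g] : $|{injfun Conv adj [set u; v; w] >->
    Conv adj [set u; v] `*` Conv adj [set v; w]}|.
  apply/injfunPex; exists f.
    move=> x /Conv_sub_between_union; rewrite /f.
    case: asboolP => [uxv _|nuxv [] // vxw]; split.
    - exact: between_sub_Conv.
    - by apply: sub_gen_smallest; left.
    - by apply: sub_gen_smallest; right.
    - exact: between_sub_Conv.
  (* In the mixed case, [(x, v) = (v, y)] forces [x = v = y]. *)
  by move=> x y _ _; rewrite /f; case: ifP => _; case: ifP => _ [] // -> ->.
exact: inj_card_le g.
Qed.
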